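(* Let $\mathcal A=\{p_1,\dots,p_n\}$ be a planar point set in general position with $n\ge 4$, and with $p_1,p_2$ having different second coordinates. A vector $f\in\mathbb R^{\binom{n+1}{2}}$ is valid if and only if, for every four points $\{p_a,p_b,p_c,p_d\}$ of $\mathcal A$, $$\sum_{i<j,\ i,j\in\{a,b,c,d\}}w_{ij}f_{ij}+\sum_{j\in\{a,b,c,d\}}\alpha_jf_{0j}>0.$$ Here $w_{ij}$ and $\alpha_j$ are computed within these four points as follows: - $w_{ij}=1/\big(\det(p_i,p_j,p_k)\det(p_i,p_j,p_l)\big)$, where $\{k,l\}$ are the other two indices; - $\alpha_j=\sum_{i\ne j}w_{ij}|p_i-p_j|$, the sum running over the other three indices.
   Context: $\det(x,y,z)$ is the determinant of the $3\times 3$ matrix with columns $(x,1),(y,1),(z,1)$. Let $S=\{(v,t)\in(\mathbb R^2)^n\times\mathbb R^n: v_1^1=v_1^2=v_2^1=0\}$. For $f=(f_{ij})_{0\le i<j\le n}$, the polyhedron $\overline{Y_f}(\mathcal A)$ is the set of $(v,t)\in S$ satisfying both of: - $\langle p_i-p_j,v_i-v_j\rangle-|p_i-p_j|(t_i+t_j)\ge f_{ij}$ for $1\le i<j\le n$; - $t_j\ge f_{0j}$ for all $j$. The tight marked graph of a face consists of: - the edges $p_ip_j$ whose inequality holds with equality on the relative interior of the face; - the marks at the points $p_j$ whose inequality $t_j\ge f_{0j}$ holds with equality there. A marked graph is non-crossing if no two edges cross and every marked vertex is pointed, i.e. its incident edges span an angle smaller than $180^\circ$. The choice $f$ is valid if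 every face of $\overline{Y_f}(\mathcal A)$ has a non-crossing tight marked graph. *)

(* Defs.v *)
From HB Require Import structures.
From mathcomp Require Import all_boot all_order all_algebra.
From mathcomp Require Import reals.
Set Implicit Arguments. Unset Strict Implicit. Unset Printing Implicit Defensive.
Import Order.TTheory GRing.Theory Num.Theory.
Local Open Scope ring_scope.

Section Defs.
Variable R : realType.
Variable n : nat.

Definition pt := (R * R)%type.

(* det(x,y,z) = determinant of the 3x3 matrix with columns (x,1),(y,1),(z,1) *)
Definition det3 (x y z : pt) : R :=
  x.1 * (y.2 - z.2) - y.1 * (x.2 - z.2) + z.1 * (x.2 - y.2).

Definition dot (x y : pt) : R := x.1 * y.1 + x.2 * y.2.
Definition sub (x y : pt) : pt := (x.1 - y.1, x.2 - y.2).
Definition dist (x y : pt) : R := Num.sqrt ((x.1 - y.1) ^+ 2 + (x.2 - y.2) ^+ 2).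

Definition general_position (p : 'I_n -> pt) : Prop :=
  forall i j k : 'I_n, i != j -> j != k -> i != k -> det3 (p i) (p j) (p k) != 0.

Record config := Config { vx : 'I_n -> R; vy : 'I_n -> R; tt : 'I_n -> R }.

Definition vv (x : config) (i : 'I_n) : pt := (vx x i, vy x i).

Definition lin (c x : config) : R :=
  \sum_(i < n) (vx c i * vx x i + vy c i * vy x i + tt c i * tt x i).
Definition comb (a b : R) (x y : config) : config :=
  Config (fun i => a * vx x i + b * vx y i) (fun i => a * vy x i + b * vy y i)
         (fun i => a * tt x i + b * tt y i).

(* S : v_1^1 = v_1^2 = v_2^1 = 0  (p_1, p_2 have 0-based indices 0, 1) *)
Definition inS (x : config) : Prop :=
  (forall i : 'I_n, val i = 0%N -> vx x i = 0 /\ vy x i = 0) /\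
  (forall i : 'I_n, val i = 1%N -> vx x i = 0).

Definition edge_lhs (p : 'I_n -> pt) (x : config) (i j : 'I_n) : R :=
  dot (sub (p i) (p j)) (sub (vv x i) (vv x j)) - dist (p i) (p j) * (tt x i + tt x j).

(* f = (f_ij)_{0<=i<j<=n}: fe i j = f_{ij} for points i < j (other entries unused),
   f0 j = f_{0j} *)
Definition Yf (p : 'I_n -> pt) (fe : 'I_n -> 'I_n -> R) (f0 : 'I_n -> R)
  (x : config) : Prop :=
  inS x /\
  (forall i j : 'I_n, (i < j)%N -> edge_lhs p x i j >= fe i j) /\
  (forall j : 'I_n, tt x j >= f0 j).

Definition is_face (P F : config -> Prop) : Prop :=
  (exists x, F x) /\
  exists (c : config) (d : R),
    (forall y, P y -> inS y -> lin c y >= d) /\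
    (forall y, F y <-> (P y /\ inS y /\ lin c y = d)).

Definition relint (F : config -> Prop) (x : config) : Prop :=
  F x /\ forall y, F y -> exists e : R, 0 < e /\ F (comb (1 + e) (- e) x y).

Definition tight_edge (p : 'I_n -> pt) (fe : 'I_n -> 'I_n -> R)
  (F : config -> Prop) (i j : 'I_n) : Prop :=
  (i < j)%N /\ forall x, relint F x -> edge_lhs p x i j = fe i j.
Definition tight_mark (f0 : 'I_n -> R) (F : config -> Prop) (j : 'I_n) : Prop :=
  forall x, relint F x -> tt x j = f0 j.

Definition segments_meet (a b c d : pt) : Prop :=
  exists s u : R, 0 <= s <= 1 /\ 0 <= u <= 1 /\
    (1 - s) * a.1 + s * b.1 = (1 - u) * c.1 + u * d.1 /\
    (1 - s) * a.2 + s * b.2 = (1 - u) * c.2 + u * d.2.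

Definition non_crossing (p : 'I_n -> pt) (E : 'I_n -> 'I_n -> Prop)
  (M : 'I_n -> Prop) : Prop :=
  (forall i j k l : 'I_n, E i j -> E k l ->
      i != k -> i != l -> j != k -> j != l ->
      ~ segments_meet (p i) (p j) (p k) (p l)) /\
  (forall j : 'I_n, M j ->
      (* pointed: incident edges lie in an open half-plane at p_j,
         i.e. span an angle smaller than 180 degrees *)
      exists u : pt, forall k : 'I_n, (E j k \/ E k j) -> 0 < dot u (sub (p k) (p j))).

Definition valid (p : 'I_n -> pt) (fe : 'I_n -> 'I_n -> R) (f0 : 'I_n -> R) : Prop :=
  forall F, is_face (Yf p fe f0) F ->
    non_crossing p (tight_edge p fe F) (tight_mark f0 F).

Definition wQ (p : 'I_n -> pt) (Q : {set 'I_n}) (i j : 'I_n) : R :=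
  (\prod_(k in (Q :\ i) :\ j) det3 (p i) (p j) (p k))^-1.
Definition alphaQ (p : 'I_n -> pt) (Q : {set 'I_n}) (j : 'I_n) : R :=
  \sum_(i in Q | i != j) wQ p Q i j * dist (p i) (p j).
Definition fourSum (p : 'I_n -> pt) (fe : 'I_n -> 'I_n -> R) (f0 : 'I_n -> R)
  (Q : {set 'I_n}) : R :=
  \sum_(i in Q) \sum_(j in Q | (i < j)%N) wQ p Q i j * fe i j
  + \sum_(j in Q) alphaQ p Q j * f0 j.

End Defs.

(* Main.v *)
Require Import Defs.
From HB Require Import structures.
From mathcomp Require Import all_boot all_order all_algebra.
From mathcomp Require Import boolp classical_sets reals.
From mathcomp Require Import ring lra.
Set Implicit Arguments. Unset Strict Implicit. Unset Printing Implicit Defensive.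
Import Order.TTheory GRing.Theory Num.Theory.
Local Open Scope ring_scope.

(** A self-stress of the complete graph on a four-point set [Q] has, up to scale,
    the weights [w_ij]; extended by the weights [alpha_j] on the marks it is a
    linear dependency among the constraints, so for every configuration the
    weighted sum of the slacks on [Q] equals [- fourSum Q].  The elements of
    negative weight are the two diagonals of [Q] (convex position) or the three
    inner edges with the inner mark (otherwise); hence a marked graph is
    non-crossing iff it contains no such negative support.  If all the sums are
    positive, a negative support cannot be tight, since the weighted slack would
    be nonnegative.

    Conversely, assume non-crossing tight graphs and [fourSum Q <= 0], and
    minimize over the polyhedron the positive part [W+] of the dependency.  Let
    [l >= 0] be dual multipliers at an optimal [x]; they are supported on the
    constraints tight at [x], and [W+ - l] is a stress with no positive
    coefficient outside [Q].  At a point outside [Q] it vanishes: its mark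
    coefficient is the weighted sum of the edge lengths, so if it is nonzero then
    the point is marked and therefore pointed, and no nonzero stress of constant
    sign is in equilibrium at a pointed vertex.  So [W+ - l] is a multiple [k] of
    the dependency on [Q].  If [k > 0], the negative support is contained in the
    support of [l] and so is tight; if [k <= 0], the positive support is tight,
    and then so is the negative one because the sum of the slacks is
    nonnegative. *)

(** * Linear programming *)

(* Bartl's induction on the number of inequalities. *)
Lemma farkas (R : realFieldType) (W : lmodType R) (I : eqType) (r : seq I)
    (a : I -> W -> R) (g : W -> R) :
  uniq r -> (forall i, scalar (a i)) -> scalar g ->
  (forall x, (forall i, i \in r -> 0 <= a i x) -> 0 <= g x) ->
  exists2 l : I -> R, (forall i, 0 <= l i) &
    forall x, g x = \sum_(i <- r) l i * a i x.
Proof.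
elim: r a g => [|j r IH] a g /=.
  move=> _ _ lg pos; exists (fun=> 0) => // x; rewrite big_nil; apply/eqP.
  have gN : g (- x) = - g x.
    have g0 : g 0 = 0 by have := lg (-1) 0 0; rewrite scaler0 addr0; lra.
    by have := lg (-1) x 0; rewrite scaleN1r addr0 => ->; rewrite g0; lra.
  by rewrite eq_le -oppr_ge0 -gN !pos.
move=> /andP[jr ur] la lg pos.
(* If the other inequalities already imply [0 <= g x], then [j] gets multiplier 0; otherwise some
   [x0] satisfies them with [g x0 < 0], hence [a j x0 < 0]. *)
case: (pselect (forall x, (forall i, i \in r -> 0 <= a i x) -> 0 <= g x)).
  move=> /(IH _ _ ur la lg)[l l0 gE].
  exists (fun i => if i == j then 0 else l i) => [i|x]; first by case: ifP.
  rewrite big_cons eqxx mul0r add0r gE; apply: eq_big_seq => i ir.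
  by rewrite ifN //; apply: contraNneq jr => <-.
move=> /existsNP[x0 /not_implyP[x0r /negP]]; rewrite -ltNge => gx0.
have k0 : a j x0 < 0.
  rewrite ltNge; apply/negP => ajx0; move: gx0; apply/negP; rewrite -leNgt.
  by apply: pos => i; rewrite inE => /predU1P[->|/x0r].
(* [pr] projects along [x0] onto the kernel of [a j], where inequality [j] is trivial, so induction
   applies after composing with [pr]. *)
set k := a j x0 in k0; pose pr x := (- (a j x / k)) *: x0 + x.
have lpr f x : scalar f -> f (pr x) = f x - a j x / k * f x0.
  by move=> lf; rewrite lf; ring.
have lcomp f : scalar f -> scalar (f \o pr).
  by move=> lf c u v; rewrite /= !lpr // lf la; ring.
have [|x hx|l l0 gE] := IH (fun i => a i \o pr) (g \o pr) ur _ (lcomp _ lg).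
- by move=> i; apply/lcomp/la.
- apply: pos => i; rewrite inE => /predU1P[->|/hx //].
  by rewrite lpr // divfK ?subrr // lt_eqF.
have s0 : 0 <= \sum_(i <- r) l i * a i x0.
  by rewrite big_seq; apply: sumr_ge0 => i ir; rewrite mulr_ge0 ?x0r.
(* The multiplier of [j] collects the multiples of [a j x] that [pr] introduces; its numerator and
   [k] are both negative. *)
exists (fun i => if i == j then (g x0 - \sum_(i <- r) l i * a i x0) / k else l i).
  move=> i; case: ifP => // _; rewrite -mulrNN mulr_ge0 //; first by lra.
  by rewrite oppr_ge0 invr_le0 ltW.
move=> x; rewrite big_cons eqxx.
have := gE x; rewrite /= lpr // => /(canRL (subrK _)) ->.
under eq_bigr => i _ do rewrite lpr // mulrBr mulrCA.
rewrite sumrB -mulr_sumr.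
have -> : \sum_(i <- r) (if i == j then (g x0 - \sum_(i <- r) l i * a i x0) / k
    else l i) * a i x = \sum_(i <- r) l i * a i x.
  apply: eq_big_seq => i ir; rewrite ifN //.
  by apply: contraNneq jr => <-.
by ring.
Qed.

Section LinearProgramming.
Variables (R : realType) (W : lmodType R) (I : finType).
Variables (a : I -> W -> R) (b : I -> R) (h : W -> R).
Hypotheses (la : forall i, scalar (a i)) (lh : scalar h).

Let feasible x := forall i, b i <= a i x.

Let scalarZ (f : W -> R) c x : scalar f -> f (c *: x) = c * f x.
Proof.
move=> lf; have f0 : f 0 = 0 by have := lf (-1) 0 0; rewrite scaler0 addr0; lra.
by have := lf c x 0; rewrite addr0 f0 addr0.
Qed.

(** Homogenization: with [z.2] as extra coordinate, unsolvability means that no solution of the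
    homogeneous system has [z.2 > 0]. *)
Lemma farkas_sublevel (v : R) :
  (forall (l : I -> R) m, (forall i, 0 <= l i) -> 0 <= m ->
     (forall x, \sum_i l i * a i x = m * h x) -> \sum_i l i * b i <= m * v) ->
  exists2 x, feasible x & h x <= v.
Proof.
move=> cert; apply: contrapT => nex.
pose A (o : option I) (z : W * R^o) : R :=
  if o is Some i then a i z.1 - b i * z.2 else v * z.2 - h z.1.
have lA o : scalar (A o).
  by case: o => [i|] c [x s] [y t] /=; rewrite ?la ?lh /GRing.scale /=; ring.
have lg : scalar (fun z : W * R^o => - z.2 : R).
  by move=> c [x s] [y t] /=; rewrite /GRing.scale /=; ring.
have [|l l0 gE] := farkas (index_enum_uniq (option I)) lA lg.
  move=> [x s] /= hx; rewrite oppr_ge0 leNgt; apply/negP => s0; apply: nex.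
  exists (s^-1 *: x) => [i|]; rewrite scalarZ //.
    have := hx (Some i) (mem_index_enum _); rewrite /= subr_ge0 mulrC.
    by rewrite -ler_pdivlMl.
  have := hx None (mem_index_enum _); rewrite /= subr_ge0 mulrC.
  by rewrite -ler_pdivrMl.
have sumE z : - z.2 = l None * (v * z.2 - h z.1)
    + \sum_i l (Some i) * (a i z.1 - b i * z.2).
  have := gE z; rewrite (bigD1 None) //= => ->; congr (_ + _).
  rewrite (reindex_omap Some id); last by case.
  by apply: eq_bigl => i /=; rewrite eqxx.
(* With [m = l None], the values at [(x, 0)] and [(0, 1)] give multipliers with
   [\sum_i l i * b i = m * v + 1], against [cert]. *)
have := cert (fun i => l (Some i)) (l None) (fun i => l0 _) (l0 _).
apply/not_implyP; split=> [x|].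
  have := sumE (x, 0); rewrite /= mulr0 sub0r oppr0 mulrN.
  by under eq_bigr do rewrite mulr0 subr0; lra.
have f0 (f : W -> R) : scalar f -> f 0 = 0.
  by move=> lf; rewrite -(scale0r 0) scalarZ // mul0r.
have := sumE (0, 1); rewrite /= f0 // mulr1 subr0.
under eq_bigr do rewrite f0 // mulr1 sub0r mulrN.
by rewrite sumrN => eqn; apply/negP; rewrite -ltNge; lra.
Qed.

(** The infimum is attained by [farkas_sublevel]; Farkas on the homogenized polyhedron then yields
    the dual multipliers, with complementary slackness. *)
Lemma lp_optimum (x0 : W) (lb : R) :
  feasible x0 -> (forall x, feasible x -> lb <= h x) ->
  exists x, feasible x /\ exists l : I -> R, [/\ forall i, 0 <= l i,
    forall y, h y = \sum_i l i * a i y & forall i, l i != 0 -> a i x = b i].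
Proof.
move=> fx0 hlb.
pose V := [set h x | x in [set x | feasible x]]%classic.
have V0 : (V !=set0)%classic by exists (h x0), x0.
have Vlb : has_lbound V by exists lb => _ [x fx <-]; exact: hlb.
have inf_le x : feasible x -> inf V <= h x.
  by move=> fx; apply: ge_inf => //; exists x.
have [|x fx hx] := @farkas_sublevel (inf V).
  move=> l m l0 m0 lE; have [mE|mn0] := eqVneq m 0.
    apply: (@le_trans _ _ (\sum_i l i * a i x0)); last by rewrite lE mE !mul0r.
    by apply: ler_sum => i _; rewrite ler_wpM2l.
  rewrite -ler_pdivrMl ?lt0r ?mn0 //; apply: lb_le_inf => // _ [y fy <-].
  rewrite ler_pdivrMl ?lt0r ?mn0 // -lE.
  by apply: ler_sum => i _; rewrite ler_wpM2l.
exists x; split => //.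
pose A (o : option I) (z : W * R^o) : R :=
  if o is Some i then a i z.1 - b i * z.2 else z.2.
have lA o : scalar (A o).
  by case: o => [i|] c [y s] [z t] /=; rewrite ?la ?lh /GRing.scale /=; ring.
have lg : scalar (fun z : W * R^o => h z.1 - inf V * z.2 : R).
  by move=> c [y s] [z t] /=; rewrite lh /GRing.scale /=; ring.
have [|l l0 gE] := farkas (index_enum_uniq (option I)) lA lg.
  move=> [y s] /= hy; have s0 : 0 <= s := hy None (mem_index_enum _).
  have hyi i : b i * s <= a i y.
    by rewrite -subr_ge0; exact: hy (Some i) (mem_index_enum _).
  (* For [s = 0] the vector [y] is a recession direction, and adding it to the minimizer cannot
     lower [h]. *)
  rewrite subr_ge0; have [sE|sn0] := eqVneq s 0.
    rewrite sE mulr0.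
    have : h x <= h (1 *: y + x).
      apply: le_trans hx _; apply: inf_le => i; rewrite la mul1r.
      by have := hyi i; have := fx i; rewrite sE mulr0; lra.
    by rewrite lh; lra.
  have sp : 0 < s by rewrite lt0r sn0.
  rewrite mulrC -ler_pdivlMl // -scalarZ //; apply: inf_le => i.
  by rewrite scalarZ // ler_pdivlMl // mulrC.
have sumE z : h z.1 - inf V * z.2 = l None * z.2
    + \sum_i l (Some i) * (a i z.1 - b i * z.2).
  have := gE z; rewrite (bigD1 None) //= => ->; congr (_ + _).
  rewrite (reindex_omap Some id); last by case.
  by apply: eq_bigl => i /=; rewrite eqxx.
exists (fun i => l (Some i)); split => // [y|i li].
  have := sumE (y, 0); rewrite /= !mulr0 subr0 add0r => ->.
  by apply: eq_bigr => i _; rewrite mulr0 subr0.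
(* At [(x, 1)] the left side is at most 0 and each term on the right is nonnegative, so every
   product of multiplier and slack vanishes. *)
have t0 j : 0 <= l (Some j) * (a j x - b j * 1).
  by rewrite mulr1 mulr_ge0 // subr_ge0.
have s0 : \sum_i l (Some i) * (a i x - b i * 1) = 0.
  apply/eqP; rewrite eq_le sumr_ge0 // andbT.
  by have := sumE (x, 1); have := l0 None; rewrite /= !mulr1; lra.
have /eqP := s0; rewrite psumr_eq0 // => /allP/(_ i (mem_index_enum _)).
by rewrite /= mulf_eq0 (negPf li) /= mulr1 subr_eq0 => /eqP.
Qed.
End LinearProgramming.

(** * Planar geometry *)

Section PlanarGeometry.
Variable R : realType.
Implicit Types x y z t u : pt R.

Lemma det3_rot x y z : det3 x y z = det3 y z x.
Proof. by rewrite /det3; ring. Qed.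

Lemma det3_swap x y z : det3 x y z = - det3 x z y.
Proof. by rewrite /det3; ring. Qed.

Lemma det3_4 x y z t :
  det3 y z t = det3 x y z + det3 x z t + det3 x t y.
Proof. by rewrite /det3; ring. Qed.

Lemma distC x y : dist x y = dist y x.
Proof. by rewrite /dist -!(opprB y.1) -!(opprB y.2) !sqrrN. Qed.

Lemma dist_ge0 x y : 0 <= dist x y.
Proof. exact: sqrtr_ge0. Qed.

Lemma sqr_dist x y : dist x y ^+ 2 = (x.1 - y.1) ^+ 2 + (x.2 - y.2) ^+ 2.
Proof. by rewrite sqr_sqrtr // addr_ge0 // sqr_ge0. Qed.

(* The triangle inequality bounds [- wt |x-t|] by [wy |x-y| + wz |x-z|]. *)
Lemma balanced_dist_ge0 x y z t (wy wz wt : R) :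
  wy * (x.1 - y.1) + wz * (x.1 - z.1) + wt * (x.1 - t.1) = 0 ->
  wy * (x.2 - y.2) + wz * (x.2 - z.2) + wt * (x.2 - t.2) = 0 ->
  0 <= wy -> 0 <= wz ->
  0 <= wy * dist x y + wz * dist x z + wt * dist x t.
Proof.
move=> e1 e2 wy0 wz0.
have [dy dz dt] := And3 (dist_ge0 x y) (dist_ge0 x z) (dist_ge0 x t).
have sum0 : 0 <= wy * dist x y + wz * dist x z by rewrite addr_ge0 ?mulr_ge0.
have [wt0|wt0] := leP 0 wt; first by rewrite addr_ge0 ?mulr_ge0.
suff : - wt * dist x t <= wy * dist x y + wz * dist x z by lra.
(* Cauchy-Schwarz: the difference of the squares is the square of a cross product. *)
have CS : (x.1 - y.1) * (x.1 - z.1) + (x.2 - y.2) * (x.2 - z.2)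
    <= dist x y * dist x z.
  have [|neg] := leP 0 ((x.1 - y.1) * (x.1 - z.1) + (x.2 - y.2) * (x.2 - z.2));
    last by rewrite (le_trans (ltW neg)) ?mulr_ge0.
  move=> pos; rewrite -ler_sqr ?nnegrE ?mulr_ge0 // exprMn !sqr_dist -subr_ge0.
  rewrite [X in 0 <= X](_ : _ =
    ((x.1 - y.1) * (x.2 - z.2) - (x.2 - y.2) * (x.1 - z.1)) ^+ 2) ?sqr_ge0 //.
  by ring.
rewrite -ler_sqr ?nnegrE //; last by rewrite mulr_ge0 // oppr_ge0 ltW.
have lhsE : (- wt * dist x t) ^+ 2 =
    (wy * (x.1 - y.1) + wz * (x.1 - z.1)) ^+ 2 +
    (wy * (x.2 - y.2) + wz * (x.2 - z.2)) ^+ 2.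
  rewrite exprMn sqr_dist mulrDr -!exprMn.
  by congr (_ ^+ 2 + _ ^+ 2); lra.
have rhsE : (wy * dist x y + wz * dist x z) ^+ 2 =
    wy ^+ 2 * ((x.1 - y.1) ^+ 2 + (x.2 - y.2) ^+ 2) +
    wz ^+ 2 * ((x.1 - z.1) ^+ 2 + (x.2 - z.2) ^+ 2) +
    2 * (wy * wz) * (dist x y * dist x z).
  by rewrite -!sqr_dist; ring.
rewrite lhsE rhsE -subr_ge0.
rewrite [X in 0 <= X](_ : _ = 2 * (wy * wz) * (dist x y * dist x z -
  ((x.1 - y.1) * (x.1 - z.1) + (x.2 - y.2) * (x.2 - z.2)))); last by ring.
by rewrite !mulr_ge0 // subr_ge0.
Qed.

Lemma opposite_signs_meet x y z t :
  det3 x y z * det3 x y t < 0 -> det3 z t x * det3 z t y < 0 ->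
  segments_meet x y z t.
Proof.
have frac (a b : R) : a * b < 0 -> a - b != 0 /\ 0 <= a / (a - b) <= 1.
  move=> ab; have [a0|a0] := ltrP 0 a.
    have b0 : b < 0 by move: ab; rewrite pmulr_rlt0.
    have d0 : 0 < a - b by lra.
    by rewrite gt_eqF // divr_ge0 ?ler_pdivrMr //; lra.
  have a0' : a < 0 by rewrite lt_neqAle a0 andbT; apply: contraTneq ab => ->; lra.
  have b0 : 0 < b by move: ab; rewrite nmulr_rlt0.
  have d0 : a - b < 0 by lra.
  by rewrite lt_eqF // ler_ndivrMr // mul1r -mulrNN mulr_ge0 ?oppr_ge0 ?invr_le0; lra.
move=> /frac[n1 i1] /frac[n2 i2].
(* [det3 z t] is affine along the segment from [x] to [y], and this is the parameter of its zero;
   the second witness comes likewise from [det3 x y]. *)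
exists (det3 z t x / (det3 z t x - det3 z t y)).
exists (det3 x y z / (det3 x y z - det3 x y t)).
split=> //; split=> //.
have -> : det3 x y z - det3 x y t = - (det3 z t x - det3 z t y).
  by rewrite /det3; ring.
set d := det3 z t x - det3 z t y in n1 *.
have conv a (v w : R) : (1 - a / d) * v + a / d * w = (d * v + a * (w - v)) / d.
  by field.
have -> : det3 x y z / - d = - det3 x y z / d by rewrite invrN mulrN mulNr.
by rewrite !conv; split; congr (_ / d);
  rewrite /d /det3; ring.
Qed.

Lemma meet_opposite_sides x y z t :
  det3 z t x != 0 -> det3 z t y != 0 ->
  segments_meet x y z t -> det3 z t x * det3 z t y < 0.
Proof.
move=> n1 n2 [s [u [/andP[s0 s1] [/andP[u0 u1] [E1 E2]]]]].
have E : (1 - s) * det3 z t x + s * det3 z t y = 0.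
  rewrite [LHS](_ : _ = (z.1 - t.1) * (z.2 - ((1 - s) * x.2 + s * y.2))
     - (z.2 - t.2) * (z.1 - ((1 - s) * x.1 + s * y.1))); last by rewrite /det3; ring.
  by rewrite E1 E2; ring.
rewrite ltNge; apply/negP => pos.
have pos' : 0 < det3 z t x * det3 z t y by rewrite lt0r pos mulf_neq0.
have : 0 < (1 - s) * det3 z t x ^+ 2 + s * (det3 z t x * det3 z t y).
  have sq : 0 < det3 z t x ^+ 2 by rewrite exprn_even_gt0.
  have [->|sn] := eqVneq s 0; first by rewrite subr0 mul1r mul0r addr0.
  apply: ltr_wpDl; first by rewrite mulr_ge0 ?(ltW sq) // subr_ge0.
  by rewrite mulr_gt0 // lt0r sn.
rewrite (_ : _ + _ = det3 z t x * ((1 - s) * det3 z t x + s * det3 z t y)); last by ring.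
by rewrite E mulr0 ltxx.
Qed.

Lemma segments_meetC x y z t : segments_meet x y z t -> segments_meet z t x y.
Proof. by move=> [s [u [? [? [E1 E2]]]]]; exists u, s. Qed.

End PlanarGeometry.

(** * Four-point stresses *)

(** A labelling of [Q]; the transposition lemmas carry facts from one labelling to the others. *)
Definition quad (T : finType) (Q : {set T}) (i j k l : T) : Prop :=
  uniq [:: i; j; k; l] /\ Q =i [:: i; j; k; l].

Section Quad.
Variables (T : finType) (Q : {set T}).

Lemma quad_swap12 i j k l : quad Q i j k l -> quad Q j i k l.
Proof.
have p : perm_eq [:: i; j; k; l] [:: j; i; k; l].
  by rewrite (perm_catCA [:: i] [:: j]).
by move=> [u e]; split => [|x]; rewrite -?(perm_uniq p) // e (perm_mem p).
Qed.

Lemma quad_swap23 i j k l : quad Q i j k l -> quad Q i k j l.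
Proof.
have p : perm_eq [:: i; j; k; l] [:: i; k; j; l].
  by rewrite perm_cons (perm_catCA [:: j] [:: k]).
by move=> [u e]; split => [|x]; rewrite -?(perm_uniq p) // e (perm_mem p).
Qed.

Lemma quad_swap34 i j k l : quad Q i j k l -> quad Q i j l k.
Proof.
have p : perm_eq [:: i; j; k; l] [:: i; j; l; k].
  by rewrite !perm_cons (perm_catCA [:: k] [:: l]).
by move=> [u e]; split => [|x]; rewrite -?(perm_uniq p) // e (perm_mem p).
Qed.

Lemma quad_mem i j k l : quad Q i j k l ->
  [/\ i \in Q, j \in Q, k \in Q & l \in Q].
Proof. by move=> [_ e]; split; rewrite e !inE eqxx ?orbT. Qed.

Lemma quad_neq i j k l : quad Q i j k l ->
  [/\ i != j, i != k, i != l & [/\ j != k, j != l & k != l]].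
Proof.
by case; rewrite /= !inE !negb_or -!andbA => /and5P[-> -> -> -> /andP[-> /andP[-> _]]] _.
Qed.

Lemma quad_extend i j k : #|Q| = 4%N -> i \in Q -> j \in Q -> k \in Q ->
  i != j -> i != k -> j != k -> exists l, quad Q i j k l.
Proof.
move=> Q4 iQ jQ kQ ij ik jk.
have /eqP/cards1P[l lE] : #|Q :\ i :\ j :\ k| = 1%N.
  have := Q4; rewrite (cardsD1 i) iQ (cardsD1 j) !inE (eq_sym j i) ij jQ.
  rewrite (cardsD1 k) !inE (eq_sym k j) jk (eq_sym k i) ik kQ.
  by rewrite !add1n => -[->].
have inl x : (x \in Q :\ i :\ j :\ k) = (x == l) by rewrite lE inE.
exists l; split => [|x].
  have := inl l; rewrite eqxx !inE => /and4P[lk lj li _].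
  by rewrite /= !inE !negb_or ij ik jk !(eq_sym _ l) lk lj li.
have := inl x; rewrite !inE.
have [->|] := eqVneq x i; first by rewrite iQ.
have [->|] := eqVneq x j; first by rewrite jQ.
by have [->|] := eqVneq x k; first by rewrite kQ.
Qed.

Lemma quad_pair i j : #|Q| = 4%N -> i \in Q -> j \in Q -> i != j ->
  exists k l, quad Q i j k l.
Proof.
move=> Q4 iQ jQ ij; have /card_gt0P[k] : (0 < #|Q :\ i :\ j|)%N.
  have := Q4; rewrite (cardsD1 i) iQ (cardsD1 j) !inE (eq_sym j i) ij jQ.
  by rewrite !add1n => -[->].
rewrite !inE => /and3P[kj ki kQ]; rewrite eq_sym in ki; rewrite eq_sym in kj.
by have [l q] := quad_extend Q4 iQ jQ kQ ij ki kj; exists k, l.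
Qed.

Lemma quad_at i : #|Q| = 4%N -> i \in Q -> exists j k l, quad Q i j k l.
Proof.
move=> Q4 iQ; have : (0 < #|Q :\ i|)%N.
  by rewrite -(ltn_add2l (i \in Q)) -cardsD1 Q4 iQ.
move=> /card_gt0P[j]; rewrite !inE eq_sym => /andP[ij jQ].
by have [k [l q]] := quad_pair Q4 iQ jQ ij; exists j, k, l.
Qed.

Lemma quad_of_uniq i j k l : Q = [set i; j; k; l] -> uniq [:: i; j; k; l] ->
  quad Q i j k l.
Proof. by move=> -> u; split => // x; rewrite !inE !orbA. Qed.

Lemma quad_card i j k l : quad Q i j k l -> #|Q| = 4%N.
Proof. by move=> [u e]; rewrite (eq_card e); apply/card_uniqP. Qed.

Lemma quad_sum (V : zmodType) i j k l (g : T -> V) : quad Q i j k l ->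
  \sum_(x in Q | x != i) g x = g j + g k + g l.
Proof.
move=> q; have [u e] := q; have [ij ik il _] := quad_neq q.
rewrite (eq_bigl (fun x => x \in [:: j; k; l])); last first.
  move=> x; rewrite /= e !inE; have [->|_] := eqVneq x i.
    by rewrite (negPf ij) (negPf ik) (negPf il).
  by rewrite andbT.
by case/andP: u => _ u; rewrite -big_uniq //= !big_cons big_nil addr0 addrA.
Qed.

End Quad.

Lemma exists_set4 n : (4 <= n)%N -> exists Q : {set 'I_n}, #|Q| = 4%N.
Proof.
move=> n4; have wi : injective (widen_ord n4).
  by move=> k l /(congr1 val) /= /val_inj.
by exists [set widen_ord n4 k | k in 'I_4]; rewrite card_imset // card_ord.
Qed.

Section Weights.
Variables (R : realType) (n : nat) (p : 'I_n -> pt R).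
Hypothesis gp : general_position p.
Variable Q : {set 'I_n}.
Hypothesis Q4 : #|Q| = 4%N.

Local Notation D i j k := (det3 (p i) (p j) (p k)).

Lemma gp_quad i j k l : quad Q i j k l -> D i j k != 0.
Proof. by case/quad_neq => ij ik _ [jk _ _]; exact: gp. Qed.

Lemma wQE i j k l : quad Q i j k l -> wQ p Q i j = (D i j k * D i j l)^-1.
Proof.
move=> q; have [u e] := q; have [ij ik il [jk jl kl]] := quad_neq q.
rewrite /wQ (eq_bigl (fun x => x \in [:: k; l])); last first.
  move=> x; rewrite /= !inE e !inE; have [->|_] := eqVneq x j.
    by rewrite (negPf jk) (negPf jl).
  by have [->|_] := eqVneq x i; rewrite ?(negPf ik) ?(negPf il).
by rewrite -big_uniq /= ?inE ?kl // !big_cons big_nil mulr1.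
Qed.

Lemma wQC i j : i \in Q -> j \in Q -> i != j -> wQ p Q i j = wQ p Q j i.
Proof.
move=> iQ jQ ij; have [k [l q]] := quad_pair Q4 iQ jQ ij.
rewrite (wQE q) (wQE (quad_swap12 q)); congr (_^-1).
by rewrite /det3; ring.
Qed.

Lemma wQ_neq0 i j k l : quad Q i j k l -> wQ p Q i j != 0.
Proof.
move=> q; rewrite (wQE q) invr_eq0 mulf_neq0 ?(gp_quad q) //.
exact: gp_quad (quad_swap34 q).
Qed.

(** Written cyclically about [i], the weights are proportional to [y], [z], [x], the determinants
    omitting [j], [k], [l] in turn. *)
Lemma wQ_orient i j k l : quad Q i j k l ->
  let x := D i j k in let y := D i k l in let z := D i l j in
  [/\ wQ p Q i j = - (z * x)^-1, wQ p Q i k = - (x * y)^-1 &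
      wQ p Q i l = - (y * z)^-1].
Proof.
move=> q /=; rewrite (wQE q) (wQE (quad_swap23 q)).
rewrite (wQE (quad_swap23 (quad_swap34 q))).
by rewrite -!invrN; split; congr (_^-1); rewrite /det3; ring.
Qed.

(** Cleared of denominators, this is Cramer's identity for the three edge vectors at [p i]. *)
Lemma wQ_equilibrium i j k l : quad Q i j k l ->
  wQ p Q i j * ((p i).1 - (p j).1) + wQ p Q i k * ((p i).1 - (p k).1)
    + wQ p Q i l * ((p i).1 - (p l).1) = 0 /\
  wQ p Q i j * ((p i).2 - (p j).2) + wQ p Q i k * ((p i).2 - (p k).2)
    + wQ p Q i l * ((p i).2 - (p l).2) = 0.
Proof.
move=> q; have [-> -> ->] := wQ_orient q.
have x0 := gp_quad q; have y0 := gp_quad (quad_swap34 (quad_swap23 q)).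
have z0 := gp_quad (quad_swap23 (quad_swap34 q)).
have E a b c : - (D i l j * D i j k)^-1 * a + - (D i j k * D i k l)^-1 * b
    + - (D i k l * D i l j)^-1 * c =
    - (D i k l * a + D i l j * b + D i j k * c) / (D i j k * D i k l * D i l j).
  by field; rewrite x0 y0 z0.
by rewrite !E; split; apply/eqP; rewrite mulf_eq0; apply/orP; left; apply/eqP;
  rewrite /det3; ring.
Qed.

(** The cross product with [p i - p l] eliminates [c]: three pairwise independent plane vectors have
    only one dependency up to scale. *)
Lemma equilibrium_proportional i j k l (a b c : R) : quad Q i j k l ->
  a * ((p i).1 - (p j).1) + b * ((p i).1 - (p k).1) + c * ((p i).1 - (p l).1) = 0 ->
  a * ((p i).2 - (p j).2) + b * ((p i).2 - (p k).2) + c * ((p i).2 - (p l).2) = 0 ->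
  a * wQ p Q i k = b * wQ p Q i j.
Proof.
move=> q e1 e2; rewrite (wQE q) (wQE (quad_swap23 q)).
have x0 := gp_quad q; have y0 := gp_quad (quad_swap34 q).
have z0 := gp_quad (quad_swap34 (quad_swap23 q)).
have x0' := gp_quad (quad_swap23 q).
have E : a * D i j l = - b * D i k l.
  apply/eqP; rewrite -subr_eq0; apply/eqP.
  rewrite (_ : _ - _ =
    (a * ((p i).1 - (p j).1) + b * ((p i).1 - (p k).1) + c * ((p i).1 - (p l).1))
      * ((p i).2 - (p l).2) -
    (a * ((p i).2 - (p j).2) + b * ((p i).2 - (p k).2) + c * ((p i).2 - (p l).2))
      * ((p i).1 - (p l).1)); first by rewrite e1 e2; ring.
  by rewrite /det3; ring.
have -> : D i k j = - D i j k by apply: det3_swap.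
apply/eqP; rewrite -subr_eq0; apply/eqP.
rewrite (_ : _ - _ = - (a * D i j l + b * D i k l) / (D i j k * D i j l * D i k l)).
  by rewrite E; ring.
by field; rewrite x0 y0 z0.
Qed.

(* At most one weight around a vertex of [Q] is negative, unless the vertex is
   interior to the triangle of the others and all three are. *)
Lemma wQ_two_neg i j k l : quad Q i j k l ->
  wQ p Q i j < 0 -> wQ p Q i k < 0 -> wQ p Q i l < 0.
Proof.
move=> q; have [-> -> ->] := wQ_orient q; rewrite !oppr_lt0 !invr_gt0.
have := gp_quad q.
case: (ltgtP (D i j k) 0) => // x0 _.
  by rewrite nmulr_lgt0 // nmulr_rgt0 // => z0 y0; rewrite nmulr_rgt0.
by rewrite pmulr_lgt0 // pmulr_rgt0 // => z0 y0; rewrite pmulr_rgt0.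
Qed.

(** The three weights at a vertex multiply to minus a nonzero square. *)
Lemma wQ_exists_neg i j k l : quad Q i j k l ->
  0 < wQ p Q i j -> 0 < wQ p Q i k -> wQ p Q i l < 0.
Proof.
move=> q; have [-> -> ->] := wQ_orient q; rewrite !oppr_lt0 !oppr_gt0 !invr_lt0 invr_gt0.
have := gp_quad q.
case: (ltgtP (D i j k) 0) => // x0 _.
  by rewrite nmulr_llt0 // nmulr_rlt0 // => z0 y0; rewrite pmulr_rgt0.
by rewrite pmulr_llt0 // pmulr_rlt0 // => z0 y0; rewrite nmulr_rgt0.
Qed.

Lemma alphaQE i j k l : quad Q i j k l -> alphaQ p Q i =
  wQ p Q i j * dist (p i) (p j) + wQ p Q i k * dist (p i) (p k)
    + wQ p Q i l * dist (p i) (p l).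
Proof.
move=> q; rewrite /alphaQ (quad_sum _ q).
have [iQ jQ kQ lQ] := quad_mem q; have [ij ik il _] := quad_neq q.
by rewrite -!(distC (p i)) -!(@wQC i).
Qed.

(** Equilibrium and the triangle inequality. A negative mark weight thus occurs only where all three
    edge weights are negative. *)
Lemma alphaQ_ge0 i j k l : quad Q i j k l ->
  0 < wQ p Q i j -> 0 < wQ p Q i k -> 0 <= alphaQ p Q i.
Proof.
move=> q wj wk; rewrite (alphaQE q); have [e1 e2] := wQ_equilibrium q.
exact: balanced_dist_ge0 e1 e2 (ltW wj) (ltW wk).
Qed.

(** General position speaks of triples, so a third point is drawn from [Q]. *)
Lemma dist_gt0 i j : i != j -> 0 < dist (p i) (p j).
Proof.
move=> ij; have /card_gt0P[k] : (0 < #|Q :\ i :\ j|)%N.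
  by have := Q4; rewrite (cardsD1 i) (cardsD1 j (Q :\ i)); do 2 case: (_ \in _); case: #|_|.
rewrite !inE => /and3P[kj ki _]; rewrite lt0r dist_ge0 andbT.
rewrite eq_sym in ki; rewrite eq_sym in kj.
apply: contraNneq (gp ij kj ki) => /(congr1 (fun x => x ^+ 2)).
rewrite sqr_dist expr0n => /eqP; rewrite paddr_eq0 ?sqr_ge0 // !sqrf_eq0 !subr_eq0.
by case/andP => /eqP e1 /eqP e2; apply/eqP; rewrite /det3 e1 e2; ring.
Qed.

Lemma alphaQ_lt0 i j k l : quad Q i j k l ->
  wQ p Q i j < 0 -> wQ p Q i k < 0 -> wQ p Q i l < 0 -> alphaQ p Q i < 0.
Proof.
move=> q wj wk wl; rewrite (alphaQE q).
have [iQ jQ kQ lQ] := quad_mem q; have [ij ik il _] := quad_neq q.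
have dj := dist_gt0 ij; have dk := dist_gt0 ik; have dl := dist_gt0 il.
rewrite -(addr0 0) -{1}(addr0 0); apply: ltrD; first apply: ltrD.
all: by rewrite nmulr_rlt0.
Qed.

End Weights.

(** * Non-crossing marked graphs *)

Section Star.
Variables (R : realType) (n : nat) (p : 'I_n -> pt R).
Hypothesis gp : general_position p.
Variable j : 'I_n.

Local Notation D i k := (det3 (p j) (p i) (p k)).

Let Dxx i : D i i = 0. Proof. by rewrite /det3; ring. Qed.
Let DC i k : D i k = - D k i. Proof. exact: det3_swap. Qed.
Let D_neq0 i k : j != i -> j != k -> i != k -> D i k != 0.
Proof. by move=> ji jk ik; exact: gp. Qed.

Let plucker r l x y : D x y * D r l = D x r * D y l + D x l * D r y.
Proof. by rewrite /det3; ring. Qed.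

(* The induction keeps track of the extreme right and left directions [r], [l]. *)
Lemma cone_or_star (K : seq 'I_n) : (forall k, k \in K -> j != k) ->
  [\/ K = [::],
      exists r, r \in K /\ (forall y, y \in K -> y = r),
      exists r l, [/\ r \in K, l \in K, 0 < D r l &
        forall y, y \in K -> 0 <= D r y /\ 0 <= D y l] |
      exists r l x, [/\ r \in K, l \in K, x \in K &
        [/\ 0 < D r l, 0 < D l x & 0 < D x r]]].
Proof.
elim: K => [|x K IH] jK; first by constructor 1.
have jx : j != x by rewrite jK ?mem_head.
have KxK y : y \in K -> y \in x :: K by move=> yK; rewrite inE yK orbT.
have xK := mem_head x K.
have {}jK y : y \in K -> j != y by move=> yK; rewrite jK ?KxK.
case: (IH jK) => [->|[r [rK all_r]]|[r [l [rK lK rl cone]]]|[r [l [z [rK lK zK star]]]]].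
- by constructor 2; exists x; split; [rewrite inE | move=> y; rewrite inE => /eqP].
- have [xr|xr] := eqVneq x r.
    constructor 2; exists r; split; first exact: KxK.
    by move=> y; rewrite inE => /predU1P[->|/all_r].
  have rx_neq0 : D r x != 0 by rewrite D_neq0 ?(jK r) // eq_sym.
  constructor 3; have [xr0|rx0|e] := ltgtP (D r x) 0.
  + have xr1 : 0 < D x r by rewrite DC oppr_gt0.
    exists x, r; split; rewrite ?(KxK r) //.
    by move=> y; rewrite inE => /predU1P[->|/all_r ->]; rewrite ?Dxx ?(ltW xr1).
  + exists r, x; split; rewrite ?(KxK r) //.
    by move=> y; rewrite inE => /predU1P[->|/all_r ->]; rewrite ?Dxx ?(ltW rx0).
  + by rewrite e eqxx in rx_neq0.
(* The new direction lies inside the cone, beyond [l], before [r], or outside on both sides; the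
   last case is a star. *)
- have [rx|rx] := leP 0 (D r x); have [xl|xl] := leP 0 (D x l).
  + constructor 3; exists r, l; split; rewrite ?KxK //.
    by move=> y; rewrite inE => /predU1P[->|/cone].
  + have xr : r != x by apply: contraTneq xl => <-; rewrite -leNgt ltW.
    have rx0 : 0 < D r x by rewrite lt0r rx D_neq0 ?(jK r).
    constructor 3; exists r, x; split; rewrite ?(KxK r) //.
    move=> y; rewrite inE => /predU1P[->|yK]; first by rewrite Dxx.
    have [ry yl] := cone y yK; split=> //.
    rewrite DC oppr_ge0 -(pmulr_lle0 _ rl) plucker (DC x r) mulNr.
    by have := mulr_ge0 rx yl; have := mulr_le0_ge0 (ltW xl) ry; lra.
  + have lx : l != x by apply: contraTneq rx => <-; rewrite -leNgt ltW.
    have xl0 : 0 < D x l by rewrite lt0r xl D_neq0 ?(jK l) // eq_sym.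
    constructor 3; exists x, l; split; rewrite ?(KxK l) //.
    move=> y; rewrite inE => /predU1P[->|yK]; first by rewrite Dxx (ltW xl0).
    have [ry yl] := cone y yK; split=> //.
    rewrite -(pmulr_lge0 _ rl) plucker addr_ge0 // mulr_ge0 //.
    by rewrite DC oppr_ge0 ltW.
  + constructor 4; exists r, l, x; split; rewrite ?(KxK r) ?(KxK l) //.
    by split=> //; rewrite DC oppr_gt0.
- by constructor 4; exists r, l, z; split; rewrite ?KxK.
Qed.

Lemma pointed_or_star (K : seq 'I_n) : (forall k, k \in K -> j != k) ->
  (forall k, k \in K -> 0 < dist (p j) (p k)) ->
  (exists u, forall k, k \in K -> 0 < dot u (sub (p k) (p j))) \/
  exists r l x, [/\ r \in K, l \in K, x \in K &
        [/\ 0 < D r l, 0 < D l x & 0 < D x r]].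
Proof.
move=> jK dK.
case: (cone_or_star jK) => [->|[r [rK all_r]]|[r [l [rK lK rl cone]]]|star].
- by left; exists (0, 0) => k; rewrite in_nil.
- left; exists (sub (p r) (p j)) => k /all_r ->.
  have := exprn_gt0 2 (dK _ rK); rewrite distC sqr_dist /dot /sub /=.
  by rewrite -!expr2.
(* A normal to the line through [p r] and [p l]; its product with [p k - p j] is [D r k + D k l]. *)
- left; exists ((p l).2 - (p r).2, (p r).1 - (p l).1) => k kK.
  rewrite (_ : dot _ _ = D r k + D k l); last by rewrite /det3 /dot /sub /=; ring.
  have [rk kl] := cone k kK; have [->|kr] := eqVneq k r; first by rewrite Dxx add0r.
  by rewrite ltr_wpDr // lt0r rk D_neq0 ?jK // eq_sym.
- by right.
Qed.

End Star.

(** * Negative supports as the obstruction to being non-crossing *)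

Section NegativeSupport.
Variables (R : realType) (n : nat) (p : 'I_n -> pt R).
Hypothesis gp : general_position p.

Definition neg_support (E : 'I_n -> 'I_n -> Prop) (M : 'I_n -> Prop)
    (Q : {set 'I_n}) : Prop :=
  (forall i j, i \in Q -> j \in Q -> (i < j)%N -> wQ p Q i j < 0 -> E i j) /\
  (forall j, j \in Q -> alphaQ p Q j < 0 -> M j).

(** A negative edge weight says that the line through the edge separates the other two points. *)
Lemma wQ_neg_meet Q i j k l : quad Q i j k l ->
  wQ p Q i j < 0 -> wQ p Q k l < 0 -> segments_meet (p i) (p j) (p k) (p l).
Proof.
move=> q; have q' : quad Q k l i j.
  exact/quad_swap23/quad_swap12/quad_swap34/quad_swap23.
rewrite (wQE _ q) (wQE _ q') !invr_lt0; exact: opposite_signs_meet.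
Qed.

Lemma meet_wQ_neg Q i j k l : quad Q i j k l ->
  segments_meet (p i) (p j) (p k) (p l) -> wQ p Q i j < 0 /\ wQ p Q k l < 0.
Proof.
move=> q; have q' : quad Q k l i j.
  exact/quad_swap23/quad_swap12/quad_swap34/quad_swap23.
have n1 := gp_quad gp q; have n2 := gp_quad gp (quad_swap34 q).
have n3 := gp_quad gp q'; have n4 := gp_quad gp (quad_swap34 q').
move=> m; rewrite (wQE _ q) (wQE _ q') !invr_lt0.
split; last exact: meet_opposite_sides n3 n4 m.
exact: meet_opposite_sides n1 n2 (segments_meetC m).
Qed.

(** Sides of a convex quadrilateral: if [a, b] and [c, d] have opposite signs, then [a - b = d - c]
    forces [a] and [c] to have opposite signs. *)
Lemma crossing_wQ_gt0 Q i j k l : quad Q i j k l ->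
  wQ p Q i j < 0 -> wQ p Q k l < 0 -> 0 < wQ p Q i k.
Proof.
move=> q; have q' : quad Q k l i j.
  exact/quad_swap23/quad_swap12/quad_swap34/quad_swap23.
rewrite (wQE _ q) (wQE _ q') (wQE _ (quad_swap23 q)) !invr_lt0 invr_gt0.
rewrite (det3_swap (p i) (p k) (p j)) (det3_rot (p i) (p k) (p l)) mulNr oppr_gt0.
have : det3 (p i) (p j) (p k) - det3 (p i) (p j) (p l) =
       det3 (p k) (p l) (p j) - det3 (p k) (p l) (p i) by rewrite /det3; ring.
move: (det3 (p i) (p j) (p k)) => a; move: (det3 (p i) (p j) (p l)) => b.
move: (det3 (p k) (p l) (p i)) => c; move: (det3 (p k) (p l) (p j)) => d.
move=> e; case: (ltgtP a 0) => [a0|a0|->]; last by rewrite mul0r ltxx.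
  rewrite !(nmulr_rlt0 _ a0) => b0.
  case: (ltgtP c 0) => [c0|//|->]; last by rewrite mul0r ltxx.
  by rewrite nmulr_rlt0 // => d0; lra.
rewrite !(pmulr_rlt0 _ a0) => b0.
case: (ltgtP c 0) => [//|c0|->]; last by rewrite mul0r ltxx.
by rewrite pmulr_rlt0 // => d0; lra.
Qed.

Lemma non_crossing_neg_support E M (Q : {set _}) : non_crossing p E M -> #|Q| = 4%N ->
  ~ neg_support E M Q.
Proof.
move=> [cross pointed] Q4 [negE negM].
have negEs i j : i \in Q -> j \in Q -> i != j -> wQ p Q i j < 0 -> E i j \/ E j i.
  move=> iQ jQ ij w; have := ij; rewrite neq_ltn => /orP[lt|lt].
    by left; exact: negE.
  by right; apply: negE; rewrite // (wQC p Q4) // eq_sym.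
(* A vertex with two negative weights has three and is marked; pairing the equilibrium with a
   pointing direction [u] is then contradictory. *)
case: (pselect (exists i j k l, quad Q i j k l /\ wQ p Q i j < 0 /\ wQ p Q i k < 0)).
  move=> [i [j [k [l [q [wj wk]]]]]]; have wl := wQ_two_neg gp q wj wk.
  have [iQ jQ kQ lQ] := quad_mem q; have [ij ik il _] := quad_neq q.
  have [u hu] := pointed i (negM i iQ (alphaQ_lt0 gp Q4 q wj wk wl)).
  have := hu j (negEs _ _ iQ jQ ij wj).
  have := hu k (negEs _ _ iQ kQ ik wk); have := hu l (negEs _ _ iQ lQ il wl).
  have [e1 e2] := wQ_equilibrium gp q.
  have : wQ p Q i j * dot u (sub (p j) (p i)) + wQ p Q i k * dot u (sub (p k) (p i))
    + wQ p Q i l * dot u (sub (p l) (p i)) = 0.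
    transitivity (- (u.1 * 0 + u.2 * 0)); last by rewrite !mulr0 addr0 oppr0.
    by rewrite -{1}e1 -e2 /dot /sub /=; ring.
  move=> e dl dk dj.
  have := nmulr_rlt0 (dot u (sub (p j) (p i))) wj; rewrite dj.
  have := nmulr_rlt0 (dot u (sub (p k) (p i))) wk; rewrite dk.
  have := nmulr_rlt0 (dot u (sub (p l) (p i))) wl; rewrite dl.
  by move: e; lra.
(* Otherwise each vertex meets exactly one negative edge; the two negative edges are disjoint and
   cross. *)
move=> one; have pos i j k l : quad Q i j k l -> wQ p Q i j < 0 -> 0 < wQ p Q i k.
  move=> q wj; rewrite lt0r (wQ_neq0 gp (quad_swap23 q)) /= leNgt; apply/negP => wk.
  by apply: one; exists i, j, k, l.
have [i [j [k [l [q wij]]]]] : exists i j k l, quad Q i j k l /\ wQ p Q i j < 0.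
  have /card_gt0P[i iQ] : (0 < #|Q|)%N by rewrite Q4.
  have [j [k [l q]]] := quad_at Q4 iQ.
  have [wj|wj|/eqP] := ltgtP (wQ p Q i j) 0; last by rewrite (negPf (wQ_neq0 gp q)).
    by exists i, j, k, l.
  have q' := quad_swap23 q.
  have [wk|wk|/eqP] := ltgtP (wQ p Q i k) 0; last by rewrite (negPf (wQ_neq0 gp q')).
    by exists i, k, j, l.
  exists i, l, j, k; split; first exact/quad_swap23/quad_swap34.
  exact: wQ_exists_neg q wj wk.
have [iQ jQ kQ lQ] := quad_mem q; have [ij ik il [jk jl kl]] := quad_neq q.
have wik := pos _ _ _ _ q wij.
have wjk : 0 < wQ p Q j k.
  by apply: (pos _ _ _ _ (quad_swap12 q)); rewrite (wQC p Q4) // eq_sym.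
have q' : quad Q k i j l by exact/quad_swap12/quad_swap23.
have wkl : wQ p Q k l < 0.
  by apply: (wQ_exists_neg gp q'); rewrite (wQC p Q4) // eq_sym.
have wji : wQ p Q j i < 0 by rewrite (wQC p Q4) // eq_sym.
have wlk : wQ p Q l k < 0 by rewrite (wQC p Q4) // eq_sym.
have [Eij|Eji] := negEs _ _ iQ jQ ij wij; have [Ekl|Elk] := negEs _ _ kQ lQ kl wkl.
- exact: (cross _ _ _ _ Eij Ekl ik il jk jl (wQ_neg_meet q wij wkl)).
- exact: (cross _ _ _ _ Eij Elk il ik jl jk (wQ_neg_meet (quad_swap34 q) wij wlk)).
- exact: (cross _ _ _ _ Eji Ekl jk jl ik il (wQ_neg_meet (quad_swap12 q) wji wkl)).
- exact: (cross _ _ _ _ Eji Elk jl jk il ik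
    (wQ_neg_meet (quad_swap12 (quad_swap34 q)) wji wlk)).
Qed.

(** Either defect exhibits a negative support: crossing edges are the diagonals of a convex
    quadrilateral, and a non-pointed marked point is surrounded by three neighbours. *)
Lemma neg_support_non_crossing (E : 'I_n -> 'I_n -> Prop) M : (4 <= n)%N -> (forall i j, E i j -> (i < j)%N) ->
  (forall Q : {set _}, #|Q| = 4%N -> ~ neg_support E M Q) -> non_crossing p E M.
Proof.
move=> n4 ltE noneg; split.
  move=> i j k l Eij Ekl ik il jk jl meet.
  have ij : i != j by rewrite neq_ltn ltE.
  have kl : k != l by rewrite neq_ltn ltE.
  pose Q := [set i; j; k; l].
  have q : quad Q i j k l.
    by apply: quad_of_uniq; rewrite //= !inE !negb_or ij ik il jk jl kl.
  have Q4 := quad_card q; have [iQ jQ kQ lQ] := quad_mem q.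
  have [wij wkl] := meet_wQ_neg q meet.
  have wji : wQ p Q j i < 0 by rewrite (wQC p Q4) // eq_sym.
  have wlk : wQ p Q l k < 0 by rewrite (wQC p Q4) // eq_sym.
  (* All four sides are positive, and two of them meet at each vertex, so no mark weight is
     negative. *)
  have wik := crossing_wQ_gt0 q wij wkl.
  have wil := crossing_wQ_gt0 (quad_swap34 q) wij wlk.
  have wjk := crossing_wQ_gt0 (quad_swap12 q) wji wkl.
  have wjl := crossing_wQ_gt0 (quad_swap12 (quad_swap34 q)) wji wlk.
  have wki : 0 < wQ p Q k i by rewrite (wQC p Q4) // eq_sym.
  have wli : 0 < wQ p Q l i by rewrite (wQC p Q4) // eq_sym.
  have wkj : 0 < wQ p Q k j by rewrite (wQC p Q4) // eq_sym.
  have wlj : 0 < wQ p Q l j by rewrite (wQC p Q4) // eq_sym.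
  have q1 : quad Q i k l j by exact/quad_swap34/quad_swap23.
  have q2 : quad Q j k l i by exact/quad_swap34/quad_swap23/quad_swap12.
  have q3 : quad Q k i j l by exact/quad_swap12/quad_swap23.
  have q4 : quad Q l i j k by exact/quad_swap12/quad_swap23/quad_swap34.
  apply: (noneg Q Q4); split => [x y|x].
    rewrite !(proj2 q) !inE.
    case/or4P => /eqP-> /or4P[] /eqP-> //; rewrite ?ltnn // => lt w; exfalso;
      try by [move: w; rewrite ltNge ltW].
    - by move: lt; rewrite ltnNge ltnW ?ltE.
    - by move: lt; rewrite ltnNge ltnW ?ltE.
  rewrite !(proj2 q) !inE => + a0.
  case/or4P => /eqP xE; move: a0; rewrite xE ltNge.
  - by rewrite (alphaQ_ge0 gp Q4 q1).
  - by rewrite (alphaQ_ge0 gp Q4 q2).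
  - by rewrite (alphaQ_ge0 gp Q4 q3).
  - by rewrite (alphaQ_ge0 gp Q4 q4).
move=> j Mj; pose K := [seq k <- enum 'I_n | `[< E j k \/ E k j >]].
have KE k : (k \in K) = `[< E j k \/ E k j >] by rewrite mem_filter mem_enum andbT.
have jK k : k \in K -> j != k.
  by rewrite KE => /asboolP[/ltE|/ltE]; rewrite neq_ltn => ->; rewrite ?orbT.
have [Q0 Q04] := exists_set4 n4.
have dK k : k \in K -> 0 < dist (p j) (p k).
  by move=> /jK jk; apply: (dist_gt0 gp Q04).
case: (pointed_or_star gp jK dK) => [[u hu]|].
  by exists u => k Ek; apply: hu; rewrite KE; exact/asboolP.
move=> [r [l [x [rK lK xK [rl lx xr]]]]]; exfalso.
have neq a b : 0 < det3 (p j) (p a) (p b) -> a != b.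
  move=> ab; apply: contraTneq ab => ->.
  by rewrite (_ : det3 _ _ _ = 0) ?ltxx // /det3; ring.
have xr' := neq _ _ xr; rewrite eq_sym in xr'.
pose Q := [set j; r; l; x].
have q : quad Q j r l x.
  by apply: quad_of_uniq; rewrite //= !inE !negb_or !jK // (neq _ _ rl) xr' (neq _ _ lx).
have Q4 := quad_card q; have [jQ rQ lQ xQ] := quad_mem q.
have [jr jl jx _] := quad_neq q.
have [wr wl wx] := wQ_orient p q.
have {}wr : wQ p Q j r < 0 by rewrite wr oppr_lt0 invr_gt0 mulr_gt0.
have {}wl : wQ p Q j l < 0 by rewrite wl oppr_lt0 invr_gt0 mulr_gt0.
have {}wx : wQ p Q j x < 0 by rewrite wx oppr_lt0 invr_gt0 mulr_gt0.
(* The outer triangle is the sum of three positively oriented inner ones, so its sides have positive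
   weight. *)
have outer a b c : quad Q j a b c -> 0 < det3 (p j) (p a) (p b) ->
    0 < det3 (p j) (p b) (p c) -> 0 < det3 (p j) (p c) (p a) ->
    0 < wQ p Q a b /\ 0 < wQ p Q b a.
  move=> q' ab bc ca; have q2 : quad Q a b j c by exact/quad_swap23/quad_swap12.
  have [aQ bQ _ _] := quad_mem q2; have [nab _ _ _] := quad_neq q2.
  rewrite -(wQC p Q4 aQ bQ nab) (wQE _ q2).
  rewrite -(det3_rot (p j)) (det3_4 (p j) (p a)) invr_gt0.
  by split; rewrite mulr_gt0 // addr_gt0 // addr_gt0.
have q' : quad Q j l x r by exact/quad_swap34/quad_swap23.
have q'' : quad Q j x r l by exact/quad_swap23/quad_swap34.
have [wrl wlr] := outer _ _ _ q rl lx xr.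
have [wlx wxl] := outer _ _ _ q' lx xr rl.
have [wxr wrx] := outer _ _ _ q'' xr rl lx.
have Ej y : y \in K -> E j y \/ E y j by rewrite KE => /asboolP.
apply: (noneg Q Q4); split => [y z|y].
  rewrite !(proj2 q) !inE.
  case/or4P => /eqP-> /or4P[] /eqP-> //; rewrite ?ltnn // => lt w;
    try by [move: w; rewrite ltNge ltW].
  - by have [//|/ltE] := Ej _ rK; rewrite ltnNge ltnW.
  - by have [//|/ltE] := Ej _ lK; rewrite ltnNge ltnW.
  - by have [//|/ltE] := Ej _ xK; rewrite ltnNge ltnW.
  - by have [/ltE|//] := Ej _ rK; rewrite ltnNge ltnW.
  - by have [/ltE|//] := Ej _ lK; rewrite ltnNge ltnW.
  - by have [/ltE|//] := Ej _ xK; rewrite ltnNge ltnW.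
rewrite !(proj2 q) !inE => + a0.
have q1 : quad Q r l x j by exact/quad_swap34/quad_swap23/quad_swap12.
have q2 : quad Q l x r j by exact/quad_swap34/quad_swap23/quad_swap12.
have q3 : quad Q x r l j by exact/quad_swap34/quad_swap23/quad_swap12.
case/or4P => /eqP yE; move: a0; rewrite yE // ltNge.
- by rewrite (alphaQ_ge0 gp Q4 q1).
- by rewrite (alphaQ_ge0 gp Q4 q2).
- by rewrite (alphaQ_ge0 gp Q4 q3).
Qed.

End NegativeSupport.

(** * The polyhedron and its optima *)

Section Polyhedron.
Variables (R : realType) (n : nat) (p : 'I_n -> pt R).
Variables (fe : 'I_n -> 'I_n -> R) (f0 : 'I_n -> R).

Local Notation cindex := (('I_n * 'I_n) + 'I_n)%type.

(* Index pairs that are not increasing carry the trivial constraint [0 <= 0]. *)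
Definition constr (y : config R n) (o : cindex) : R :=
  match o with
  | inl ij => if (ij.1 < ij.2)%N then edge_lhs p y ij.1 ij.2 else 0
  | inr j => tt y j
  end.

Definition rhs (o : cindex) : R :=
  match o with
  | inl ij => if (ij.1 < ij.2)%N then fe ij.1 ij.2 else 0
  | inr j => f0 j
  end.

Lemma cindex_sum (G : cindex -> R) :
  \sum_o G o = \sum_i \sum_j G (inl (i, j)) + \sum_j G (inr j).
Proof.
by rewrite big_sumType pair_bigA; congr (_ + _); apply: eq_bigr => -[i j].
Qed.

Definition tight (x : config R n) (o : cindex) : Prop := constr x o = rhs o.

Lemma YfP y : Yf p fe f0 y <-> inS y /\ forall o, rhs o <= constr y o.
Proof.
split=> [[yS [ye ym]]|[yS yc]]; split=> //.
  by case=> [[i j]|j] /=; [case: ifP => // /ye | exact: ym].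
split=> [i j ij|j]; last exact: yc (inr j).
by have := yc (inl (i, j)); rewrite /= ij.
Qed.

Lemma constr_comb a b x y o : constr (comb a b x y) o = a * constr x o + b * constr y o.
Proof.
case: o => [[i j]|j] //=; case: ifP => _; last by rewrite !mulr0 addr0.
by rewrite /edge_lhs /dot /sub /vv /=; ring.
Qed.

Lemma lin_comb c a b (x y : config R n) :
  lin c (comb a b x y) = a * lin c x + b * lin c y.
Proof.
rewrite /lin !mulr_sumr -big_split; apply: eq_bigr => i _ /=; ring.
Qed.

Lemma inS_comb a b (x y : config R n) : inS x -> inS y -> inS (comb a b x y).
Proof.
move=> [x0 x1] [y0 y1]; split=> i hi /=.
  by have [-> ->] := x0 i hi; have [-> ->] := y0 i hi; rewrite !mulr0 addr0.
by rewrite x1 // y1 // !mulr0 addr0.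
Qed.

(** * Stresses as linear relations among the constraints *)

Section Stress.
Variable W : cindex -> R.

(** Symmetrized, since only increasing pairs carry a genuine constraint. *)
Definition edgew (i j : 'I_n) : R :=
  (if (i < j)%N then W (inl (i, j)) else 0) +
  (if (j < i)%N then W (inl (j, i)) else 0).

Lemma edgewC i j : edgew i j = edgew j i.
Proof. exact: addrC. Qed.

(** The coefficient vector of the functional [\sum_o W o * constr y o]: the resultant force at each
    point, and the mark weight minus the weighted edge lengths. *)
Definition stress_conf : config R n := Config
  (fun i => \sum_j edgew i j * ((p i).1 - (p j).1))
  (fun i => \sum_j edgew i j * ((p i).2 - (p j).2))
  (fun i => W (inr i) - \sum_j edgew i j * dist (p i) (p j)).

Lemma stress_sum y : \sum_o W o * constr y o = lin stress_conf y.
Proof.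
rewrite cindex_sum.
pose u (i j : 'I_n) := if (i < j)%N then W (inl (i, j)) else 0.
(* The share of endpoint [i] in the constraint of the edge [ij]. *)
pose g (i j : 'I_n) := vx y i * ((p i).1 - (p j).1) +
  vy y i * ((p i).2 - (p j).2) - tt y i * dist (p i) (p j).
have -> : \sum_i \sum_j W (inl (i, j)) * constr y (inl (i, j)) =
    \sum_i \sum_j (u i j * g i j + u i j * g j i).
  apply: eq_bigr => i _; apply: eq_bigr => j _; rewrite /u /g /=.
  case: ifP => _; last by rewrite mulr0 !mul0r addr0.
  by rewrite (distC (p j)) /edge_lhs /dot /sub /vv /=; ring.
under eq_bigr do rewrite big_split.
rewrite big_split /= [X in _ + X + _]exchange_big -!big_split /=.
rewrite /lin; apply: eq_bigr => i _ /=; rewrite -big_split /=.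
rewrite !mulr_suml mulrBl mulr_suml.
rewrite [RHS]addrA [RHS]addrAC -[in RHS]big_split -sumrB /=; congr (_ + _).
by apply: eq_bigr => j _; rewrite /edgew /g /u; ring.
Qed.

(** Evaluated on its own coefficient vector, the functional is a sum of squares. *)
Lemma stress_zero : (forall y, \sum_o W o * constr y o = 0) -> forall i,
  [/\ \sum_j edgew i j * ((p i).1 - (p j).1) = 0,
      \sum_j edgew i j * ((p i).2 - (p j).2) = 0 &
      W (inr i) = \sum_j edgew i j * dist (p i) (p j)].
Proof.
move=> /(_ stress_conf); rewrite stress_sum /lin => /eqP.
have sq (a b c : R) : 0 <= a * a + b * b + c * c.
  by rewrite -!expr2 !addr_ge0 // sqr_ge0.
rewrite psumr_eq0 => [/allP zero i|i _]; last exact: sq.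
have := zero i (mem_index_enum _); rewrite /= -!expr2.
rewrite !paddr_eq0 ?addr_ge0 ?sqr_ge0 // !sqrf_eq0 subr_eq0.
by case/andP => /andP[/eqP -> /eqP ->] /eqP ->.
Qed.

End Stress.

(** The sum of the constraints tight at [x] is minimal exactly where all of them are tight. *)
Lemma face_at x : Yf p fe f0 x -> exists2 F, is_face (Yf p fe f0) F &
  forall y, F y <-> Yf p fe f0 y /\ forall o, tight x o -> tight y o.
Proof.
move=> Yx; pose W o : R := (constr x o == rhs o)%:R.
pose F y := Yf p fe f0 y /\ forall o, tight x o -> tight y o.
have sl y : lin (stress_conf W) y - \sum_o W o * rhs o =
    \sum_o W o * (constr y o - rhs o).
  by rewrite -stress_sum -sumrB; apply: eq_bigr => o _; rewrite mulrBr.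
have W0 y o : Yf p fe f0 y -> 0 <= W o * (constr y o - rhs o).
  by case/YfP => _ yc; rewrite mulr_ge0 ?ler0n // subr_ge0.
exists F => //; split; first by exists x; split.
exists (stress_conf W), (\sum_o W o * rhs o); split => [y Yy _|y].
  by rewrite -subr_ge0 sl sumr_ge0 // => o _; exact: W0.
split => [[Yy yt]|[Yy [_ /eqP]]].
  split=> //; split; first by case: Yy.
  apply/eqP; rewrite -subr_eq0 sl big1 // => o _; rewrite /W.
  by have [/yt ->|_] := eqVneq; rewrite ?subrr ?mulr0 ?mul0r.
rewrite -subr_eq0 sl psumr_eq0 => [/allP zero|o _]; last exact: W0.
split=> // o xo; have := zero o (mem_index_enum _).
by rewrite /W xo eqxx mul1r subr_eq0 => /eqP.
Qed.

Lemma face_relint F : is_face (Yf p fe f0) F -> exists x, relint F x.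
Proof.
move=> [[x0 Fx0] [c [d [_ FE]]]].
pose T y := [set o | constr y o == rhs o].
(* A point of [F] with fewest tight constraints will be relatively interior. *)
pose P k := `[< exists2 y, F y & #|T y| = k >].
have exP : exists k, P k by exists #|T x0|; apply/asboolP; exists x0.
case: (ex_minnP exP) => k /asboolP[x Fx xk] kmin.
have [/YfP[xS xc] [_ xd]] := (FE x).1 Fx.
have Fmem z : inS z -> (forall o, rhs o <= constr z o) -> lin c z = d -> F z.
  by move=> zS zc zd; apply/FE; split; [apply/YfP|].
have tight_all y o : F y -> tight x o -> tight y o.
  move=> Fy xo; apply: contrapT => yo.
  have [/YfP[yS yc] [_ yd]] := (FE y).1 Fy.
  (* The midpoint is tight only where both ends are, so it would have fewer tight constraints than
     [x]. *)
  pose z := comb 2^-1 2^-1 x y.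
  have zE o' : constr z o' - rhs o' =
      2^-1 * (constr x o' - rhs o') + 2^-1 * (constr y o' - rhs o').
    by rewrite constr_comb; field.
  have half0 : 0 < 2^-1 :> R by rewrite invr_gt0.
  have Fz : F z.
    apply: Fmem; first exact: inS_comb.
      move=> o'; rewrite -subr_ge0 zE addr_ge0 // mulr_ge0 ?subr_ge0 // ltW //.
    by rewrite lin_comb xd yd; field.
  have : (k <= #|T z|)%N by apply: kmin; apply/asboolP; exists z.
  rewrite -xk leqNgt => /negP; apply; apply: proper_card; apply/properP; split.
    apply/fintype.subsetP => o'; rewrite !inE -subr_eq0 zE.
    rewrite paddr_eq0 ?mulr_ge0 ?subr_ge0 // ?ltW //.
    by rewrite mulf_eq0 gt_eqF //= subr_eq0 => /andP[].
  exists o; first by rewrite inE; apply/eqP.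
  rewrite inE -subr_eq0 zE xo subrr mulr0 add0r mulf_eq0 gt_eqF //= subr_eq0.
  exact/eqP.
exists x; split=> // y Fy.
have [/YfP[yS yc] [_ yd]] := (FE y).1 Fy.
(* Ratios of slacks, 0 by the convention on division where [x] is tight; a step of
   [1 / (1 + \sum_o q o)] beyond [x] violates no constraint. *)
pose q o := (constr y o - rhs o) / (constr x o - rhs o).
have q0 o : 0 <= q o by rewrite divr_ge0 ?subr_ge0.
have s0 : 0 < 1 + \sum_o q o by rewrite ltr_wpDr // sumr_ge0.
exists (1 + \sum_o q o)^-1; split; first by rewrite invr_gt0.
set e := _^-1; have e0 : 0 < e by rewrite invr_gt0.
apply: Fmem; first exact: inS_comb.
  move=> o; rewrite constr_comb.
  have [xo|xo] := eqVneq (constr x o) (rhs o).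
    by rewrite xo (tight_all y o Fy xo) -mulrDl; lra.
  have x0' : 0 < constr x o - rhs o by rewrite lt0r subr_eq0 xo subr_ge0 xc.
  have qs : q o <= 1 + \sum_o q o.
    rewrite (bigD1 o) //= addrCA lerDl addr_ge0 // sumr_ge0 // => o' _; exact: q0.
  have : e * (constr y o - rhs o) <= constr x o - rhs o.
    have -> : constr y o - rhs o = q o * (constr x o - rhs o).
      by rewrite divfK // gt_eqF.
    rewrite mulrA ler_piMl ?(ltW x0') //.
    by rewrite /e mulrC ler_pdivrMr // mul1r.
  by have := mulr_ge0 (ltW e0) (ltW x0'); lra.
by rewrite lin_comb xd yd; ring.
Qed.

(** Non-crossing passes to subgraphs. The graph tight at [x] lies in that of the face from
    [face_at], and the graph of a face lies in that of any relatively interior point. *)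
Lemma valid_pointwise : valid p fe f0 <-> forall x, Yf p fe f0 x ->
  non_crossing p (fun i j : 'I_n => (i < j)%N /\ edge_lhs p x i j = fe i j)
    (fun j => tt x j = f0 j).
Proof.
split=> [vld x Yx|nc F Ff].
  have [F Ff FE] := face_at Yx; have [cross pointed] := vld F Ff.
  have tE (i j : 'I_n) : (i < j)%N /\ edge_lhs p x i j = fe i j -> tight_edge p fe F i j.
    move=> [ij e]; split=> // y [/FE[_ yt] _].
    by have := yt (inl (i, j)); rewrite /tight /= ij; exact.
  split.
    by move=> i j k l /tE Eij /tE; exact: cross.
  move=> j e; have [|u hu] := pointed j.
    by move=> y [/FE[_ yt] _]; exact: yt (inr j) e.
  by exists u => k [/tE ?|/tE ?]; apply: hu; [left|right].
have [x [Fx rx]] := face_relint Ff.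
have Yx : Yf p fe f0 x by case: Ff => _ [c [d [_ /(_ x)[/(_ Fx)[]]]]].
have xrel : relint F x by [].
have [cross pointed] := nc x Yx; split.
  move=> i j k l [ij Eij] [kl Ekl]; apply: cross; split=> //;
    [exact: Eij | exact: Ekl].
move=> j Mj; have [u hu] := pointed j (Mj x xrel).
exists u => k [[lt e]|[lt e]]; apply: hu; [left|right]; split=> //; exact: e.
Qed.

Hypotheses (n4 : (4 <= n)%N) (gp : general_position p).
Hypothesis p01 : forall i1 i2 : 'I_n, val i1 = 0%N -> val i2 = 1%N ->
  (p i1).2 != (p i2).2.

(* Infinitesimal rigid motions do not change the constraints. *)
Lemma normalize_inS x : exists2 y, inS y & forall o, constr y o = constr x o.
Proof.
pose i0 : 'I_n := Ordinal (leq_trans (isT : (0 < 4)%N) n4).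
pose i1 : 'I_n := Ordinal (leq_trans (isT : (1 < 4)%N) n4).
have d0 : (p i1).2 - (p i0).2 != 0 by rewrite subr_eq0 eq_sym p01.
(* The rotation rate about [p i0] that cancels [vx] at [i1]; [p01] keeps the denominator nonzero. *)
pose r := (vx x i0 - vx x i1) / ((p i1).2 - (p i0).2).
exists (Config (fun i => vx x i - vx x i0 + r * ((p i).2 - (p i0).2))
  (fun i => vy x i - vy x i0 - r * ((p i).1 - (p i0).1)) (tt x)).
  split=> i iE /=.
    have -> : i = i0 by exact: val_inj.
    by split; rewrite !subrr ?mulr0 ?addr0 ?subr0.
  have -> : i = i1 by exact: val_inj.
  by rewrite /r divfK //; ring.
case=> [[i j]|j] //=; case: ifP => // _.
by rewrite /edge_lhs /dot /sub /vv /=; ring.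
Qed.

(** A dilation with large factor [K] contributes [K] times the squared length to each edge
    constraint. *)
Lemma feasible_exists : exists x, forall o, rhs o <= constr x o.
Proof.
have [Q Q4] := exists_set4 n4.
pose B i j := (fe i j + dist (p i) (p j) * (f0 i + f0 j)) / dist (p i) (p j) ^+ 2.
pose K := \sum_i \sum_j `|B i j|.
exists (Config (fun i => K * (p i).1) (fun i => K * (p i).2) f0).
case=> [[i j]|j] //=; case: ifP => // ij.
have d0 : 0 < dist (p i) (p j) by apply: (dist_gt0 gp Q4); rewrite neq_ltn ij.
have BK : B i j <= K.
  apply: le_trans (ler_norm _) _; rewrite /K (bigD1 i) //= (bigD1 j) //=.
  rewrite -addrA lerDl addr_ge0 ?sumr_ge0 // => k _.
  by rewrite sumr_ge0.
have : B i j * dist (p i) (p j) ^+ 2 <= K * dist (p i) (p j) ^+ 2.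
  by rewrite ler_wpM2r // sqr_ge0.
rewrite /B divfK; last by rewrite expf_neq0 // gt_eqF.
rewrite -subr_ge0 sqr_dist -subr_ge0 subr0 /edge_lhs /dot /sub /vv /= => h.
rewrite -subr_ge0; apply: le_trans h _; rewrite le_eqVlt; apply/orP; left.
by apply/eqP; ring.
Qed.

(** Row vectors supply the vector space structure that linear programming requires. *)
Let conf_of (M : 'rV[R]_n * 'rV[R]_n * 'rV[R]_n) : config R n :=
  Config (M.1.1 0) (M.1.2 0) (M.2 0).

Let constr_scalar o : scalar (fun M => constr (conf_of M) o).
Proof.
move=> a [[u1 u2] u3] [[v1 v2] v3].
case: o => [[i j]|j] /=; last by rewrite !mxE.
case: ifP => _; last by rewrite mulr0 addr0.
by rewrite /edge_lhs /dot /sub /vv /= !mxE; ring.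
Qed.

Let constr_conf_of y o :
  constr (conf_of (\row_i vx y i, \row_i vy y i, \row_i tt y i)) o = constr y o.
Proof.
case: o => [[i j]|j] /=; last by rewrite mxE.
by case: ifP => // _; rewrite /edge_lhs /dot /sub /vv /= !mxE.
Qed.

(** The program ranges over all configurations, with objective bounded below as [W] is nonnegative;
    a rigid motion then brings the optimum into [S]. *)
Lemma weighted_optimum (W : cindex -> R) : (forall o, 0 <= W o) ->
  exists2 x, Yf p fe f0 x & exists l : cindex -> R, [/\ forall o, 0 <= l o,
    forall y, \sum_o (W o - l o) * constr y o = 0 &
    forall o, l o != 0 -> tight x o].
Proof.
move=> W0; have [x0 x0P] := feasible_exists.
pose h M := \sum_o W o * constr (conf_of M) o.
have lh : scalar h.
  move=> a u v; rewrite /h mulr_sumr -big_split; apply: eq_bigr => o _.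
  by rewrite /= constr_scalar; ring.
have [||M [fM [l [l0 hE lt]]]] := lp_optimum (b := rhs)
    (x0 := (\row_i vx x0 i, \row_i vy x0 i, \row_i tt x0 i))
    (lb := \sum_o W o * rhs o) constr_scalar lh.
- by move=> o; rewrite constr_conf_of.
- by move=> M fM; apply: ler_sum => o _; rewrite ler_wpM2l.
have [x xS xM] := normalize_inS (conf_of M).
exists x; first by apply/YfP; split=> // o; rewrite xM.
exists l; split=> // [y|o lo]; last by rewrite /tight xM lt.
have := hE (\row_i vx y i, \row_i vy y i, \row_i tt y i); rewrite /h.
under eq_bigr do rewrite constr_conf_of; under [RHS]eq_bigr do rewrite constr_conf_of.
move=> e; under eq_bigr do rewrite mulrBl.
by rewrite sumrB e subrr.
Qed.

(** * The dependency carried by four points *)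

Section FourPoints.
Variable Q : {set 'I_n}.
Hypothesis Q4 : #|Q| = 4%N.

(** Values on decreasing pairs may be nonzero; they multiply the trivial constraint. *)
Definition qstress (o : cindex) : R :=
  match o with
  | inl ij => if (ij.1 \in Q) && (ij.2 \in Q) then wQ p Q ij.1 ij.2 else 0
  | inr j => if j \in Q then alphaQ p Q j else 0
  end.

Lemma edgew_qstress i j : edgew qstress i j =
  if [&& i \in Q, j \in Q & j != i] then wQ p Q i j else 0.
Proof.
rewrite /edgew /=; have [->|ji] := eqVneq j i.
  by rewrite ltnn !andbF addr0.
have [iQ|iQ] := boolP (i \in Q); have [jQ|jQ] := boolP (j \in Q) => //=;
  try by rewrite !if_same addr0.
rewrite (wQC p Q4 jQ iQ ji).
by have [ij|ij|/val_inj e] := ltngtP i j; rewrite ?addr0 ?add0r // e eqxx in ji *.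
Qed.

Lemma edgew_qstress_sum i (g : 'I_n -> R) : \sum_j edgew qstress i j * g j =
  if i \in Q then \sum_(j in Q | j != i) wQ p Q i j * g j else 0.
Proof.
have [iQ|iQ] := ifP.
  rewrite [RHS]big_mkcond; apply: eq_bigr => j _.
  by rewrite edgew_qstress iQ /=; case: ifP => // _; rewrite mul0r.
by rewrite big1 // => j _; rewrite edgew_qstress iQ mul0r.
Qed.

Lemma qstress_zero y : \sum_o qstress o * constr y o = 0.
Proof.
rewrite stress_sum /lin big1 // => i _ /=; rewrite !edgew_qstress_sum.
case: ifP => iQ; last by rewrite subr0 !mul0r !addr0.
have [j [k [l q]]] := quad_at Q4 iQ; have [e1 e2] := wQ_equilibrium gp q.
rewrite !(quad_sum _ q) e1 e2 (alphaQE _ Q4 q) subrr.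
by rewrite !mul0r !addr0.
Qed.

Lemma fourSumE : fourSum p fe f0 Q = \sum_o qstress o * rhs o.
Proof.
rewrite /fourSum cindex_sum big_mkcond; congr (_ + _); last first.
  rewrite big_mkcond; apply: eq_bigr => j _ /=.
  by case: ifP => //; rewrite mul0r.
apply: eq_bigr => i _; case: ifP => iQ; last first.
  by rewrite big1 // => j _; rewrite /= iQ mul0r.
rewrite big_mkcond; apply: eq_bigr => j _ /=; rewrite iQ /=.
by case: (j \in Q); case: (i < j)%N; rewrite /= ?mul0r ?mulr0.
Qed.

Lemma qstress_slack y : \sum_o qstress o * (constr y o - rhs o) = - fourSum p fe f0 Q.
Proof.
under eq_bigr do rewrite mulrBr.
by rewrite sumrB qstress_zero fourSumE sub0r.
Qed.

Lemma neg_supportP x :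
  neg_support p (fun i j : 'I_n => (i < j)%N /\ edge_lhs p x i j = fe i j)
    (fun j => tt x j = f0 j) Q <->
  forall o, qstress o < 0 -> tight x o.
Proof.
split=> [[negE negM] [[i j]|j]|neg].
- rewrite /tight /=; case: ifP => [/andP[iQ jQ] w|]; last by rewrite ltxx.
  by case: ifP => // ij; case: (negE i j iQ jQ ij w).
- rewrite /tight /=; case: ifP => [jQ /negM|]; last by rewrite ltxx.
  by apply.
split=> [i j iQ jQ ij w|j jQ a].
  by split=> //; have := neg (inl (i, j)); rewrite /tight /= iQ jQ ij; apply.
by have := neg (inr j); rewrite /tight /= jQ; apply.
Qed.

Lemma edgew_zero_outside (V : cindex -> R) x j :
  (forall y, \sum_o V o * constr y o = 0) ->
  (forall k, edgew V j k <= 0) ->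
  (forall k, edgew V j k != 0 -> k != j /\
     (tight x (inl (j, k)) /\ (j < k)%N \/ tight x (inl (k, j)) /\ (k < j)%N)) ->
  (V (inr j) != 0 -> tight x (inr j)) ->
  non_crossing p (fun i j : 'I_n => (i < j)%N /\ edge_lhs p x i j = fe i j)
    (fun j => tt x j = f0 j) ->
  forall k, edgew V j k = 0.
Proof.
move=> V0 e0 et mt [_ pointed] k; have [e1 e2 em] := stress_zero V0 j.
apply/eqP; apply: contraT => ek; have [kj _] := et k ek.
(* With mark coefficient 0 the weighted lengths, all of one sign, sum to 0; otherwise [j] is
   pointed, and the equilibrium paired with [u] is again a sum of terms of one sign. *)
have [m0|/mt/pointed[u hu]] := eqVneq (V (inr j)) 0.
  have /eqP : \sum_k - edgew V j k * dist (p j) (p k) = 0.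
    under eq_bigr do rewrite mulNr.
    by rewrite sumrN -em m0 oppr0.
  rewrite psumr_eq0 => [/allP/(_ k (mem_index_enum _))|i _]; last first.
    by rewrite mulr_ge0 ?dist_ge0 // oppr_ge0.
  rewrite /= mulf_eq0 oppr_eq0 (negPf ek) /= gt_eqF //.
  by apply: (dist_gt0 gp Q4); rewrite eq_sym.
have pos i : edgew V j i != 0 -> 0 < dot u (sub (p i) (p j)).
  move=> /et[_ [[t lt]|[t lt]]]; apply: hu; [left|right]; split=> //.
    by move: t; rewrite /tight /= lt.
  by move: t; rewrite /tight /= lt.
have /eqP : \sum_i - edgew V j i * dot u (sub (p i) (p j)) = 0.
  transitivity (u.1 * \sum_i edgew V j i * ((p j).1 - (p i).1) +
      u.2 * \sum_i edgew V j i * ((p j).2 - (p i).2)).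
    rewrite !mulr_sumr -big_split; apply: eq_bigr => i _.
    by rewrite /dot /sub /=; ring.
  by rewrite e1 e2 !mulr0 addr0.
rewrite psumr_eq0 => [/allP/(_ k (mem_index_enum _))|i _]; last first.
  have [->|/pos/ltW ?] := eqVneq (edgew V j i) 0; first by rewrite oppr0 mul0r.
  by rewrite mulr_ge0 // oppr_ge0.
by rewrite /= mulf_eq0 oppr_eq0 (negPf ek) /= gt_eqF // pos.
Qed.

(** Equilibrium at each vertex of [Q] fixes the edge coefficients up to a factor, and the edges at
    [i0] make the factors agree. Marks follow as weighted lengths. *)
Lemma stress_proportional (V : cindex -> R) :
  (forall y, \sum_o V o * constr y o = 0) ->
  (forall j, j \notin Q -> forall k, edgew V j k = 0) ->
  exists k : R, (forall i j : 'I_n, (i < j)%N -> V (inl (i, j)) = k * qstress (inl (i, j)))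
    /\ forall j, V (inr j) = k * qstress (inr j).
Proof.
move=> V0 out.
have inQ i (g : 'I_n -> R) : i \in Q ->
    \sum_j edgew V i j * g j = \sum_(j in Q | j != i) edgew V i j * g j.
  move=> iQ; rewrite [RHS]big_mkcond; apply: eq_bigr => j _.
  case: ifP => // /negbT; rewrite negb_and => /orP[jQ|/negPn/eqP ->].
    by rewrite edgewC out // mul0r.
  by rewrite /edgew ltnn addr0 mul0r.
have prop i j k : i \in Q -> j \in Q -> k \in Q -> i != j -> i != k -> j != k ->
    edgew V i j * wQ p Q i k = edgew V i k * wQ p Q i j.
  move=> iQ jQ kQ ij ik jk; have [l q] := quad_extend Q4 iQ jQ kQ ij ik jk.
  have [e1 e2 _] := stress_zero V0 i.
  move: e1 e2; rewrite !inQ // !(quad_sum _ q) => e1 e2.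
  exact: (equilibrium_proportional gp q e1 e2).
have w0 i j : i \in Q -> j \in Q -> i != j -> wQ p Q i j != 0.
  move=> iQ jQ ij; have [k [l q]] := quad_pair Q4 iQ jQ ij.
  by apply: (wQ_neq0 gp q).
have /card_gt0P[i0 i0Q] : (0 < #|Q|)%N by rewrite Q4.
have [a [b [c q]]] := quad_at Q4 i0Q.
have [_ aQ _ _] := quad_mem q; have [i0a _ _ _] := quad_neq q.
pose k := edgew V i0 a / wQ p Q i0 a.
have k0 j : j \in Q -> i0 != j -> edgew V i0 j = k * wQ p Q i0 j.
  move=> jQ i0j; rewrite /k; have [->|ja] := eqVneq j a; first by rewrite divfK ?w0.
  rewrite mulrAC -(prop i0 j a) // mulfK ?w0 //.
have kE i j : i \in Q -> j \in Q -> i != j -> edgew V i j = k * wQ p Q i j.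
  move=> iQ jQ ij; have [i0i|i0i] := eqVneq i i0; first by rewrite i0i k0 // -i0i.
  have [ji0|ji0] := eqVneq j i0.
    by rewrite ji0 edgewC k0 1?eq_sym // (wQC p Q4) // eq_sym.
  apply: (mulIf (w0 _ _ iQ i0Q i0i)); rewrite prop //.
  by rewrite edgewC k0 1?eq_sym // (wQC p Q4 i0Q iQ) 1?eq_sym // mulrAC.
have kEE i j : edgew V i j = k * edgew qstress i j.
  rewrite edgew_qstress; have [iQ|iQ] := boolP (i \in Q); last by rewrite out //= mulr0.
  have [jQ|jQ] := boolP (j \in Q); last by rewrite edgewC out //= mulr0.
  have [->|ji] := eqVneq j i; last by rewrite /= kE // eq_sym.
  by rewrite /edgew ltnn addr0 mulr0.
exists k; split=> [i j ij|j].
  have := kEE i j; rewrite /edgew ij ltnNge ltnW //=.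
  by rewrite !addr0.
have [_ _ ->] := stress_zero V0 j; have [_ _ ->] := stress_zero qstress_zero j.
by rewrite mulr_sumr; apply: eq_bigr => i _; rewrite kEE mulrA.
Qed.

Lemma fourSum_gt0_no_neg_support x : Yf p fe f0 x -> 0 < fourSum p fe f0 Q ->
  ~ forall o, qstress o < 0 -> tight x o.
Proof.
move=> /YfP[_ xc] sum0 neg; suff : 0 <= - fourSum p fe f0 Q by lra.
rewrite -(qstress_slack x) sumr_ge0 // => o _.
have [/neg ->|q0] := ltP (qstress o) 0; first by rewrite subrr mulr0.
by rewrite mulr_ge0 // subr_ge0.
Qed.

Lemma fourSum_le0_neg_support :
  (forall x, Yf p fe f0 x -> non_crossing p
     (fun i j : 'I_n => (i < j)%N /\ edge_lhs p x i j = fe i j)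
     (fun j => tt x j = f0 j)) ->
  fourSum p fe f0 Q <= 0 ->
  exists2 x, Yf p fe f0 x & forall o, qstress o < 0 -> tight x o.
Proof.
move=> nc sum0; pose W o := Num.max (qstress o) 0.
have [|x Yx [l [l0 V0 lt]]] := @weighted_optimum W; first by move=> o; rewrite le_max lexx orbT.
exists x => //; pose V o := W o - l o.
have [|k [kedge kmark]] := stress_proportional V0.
  move=> j jQ.
  have Wj k : [/\ W (inl (j, k)) = 0, W (inl (k, j)) = 0 & W (inr j) = 0].
    by rewrite /W /= (negPf jQ) andbF maxxx.
  apply: (edgew_zero_outside V0 _ _ _ (nc x Yx)) => [k|k|].
  - have [w1 w2 _] := Wj k; rewrite /edgew /V w1 w2 !sub0r.
    have := l0 (inl (j, k)); have := l0 (inl (k, j)).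
    by case: ifP => _; case: ifP => _; lra.
  - have [w1 w2 _] := Wj k; rewrite /edgew /V w1 w2 !sub0r.
    have [jk|kj|/val_inj ->] := ltngtP j k; rewrite ?addr0 ?add0r ?oppr_eq0 ?eqxx //.
      by move=> /lt; split; [rewrite neq_ltn jk orbT | left].
    by move=> /lt; split; [rewrite neq_ltn kj | right].
  - by have [_ _ w] := Wj j; rewrite /V w sub0r oppr_eq0 => /lt.
have VE o : tight x o \/ W o - l o = k * qstress o.
  case: o => [[i j]|j]; last by right; exact: kmark.
  have [ij|ij] := boolP (i < j)%N; first by right; exact: kedge.
  by left; rewrite /tight /= (negPf ij).
(* Where [qstress o < 0] the positive part [W o] is 0, so [l o = - k * qstress o] is nonzero. *)
have [k0|k0] := ltP 0 k.
  move=> o qo; have [//|e] := VE o; apply: lt; apply/eqP => lo0.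
  move: e; rewrite lo0 subr0 /W max_r ?(ltW qo) // => /esym/eqP.
  by rewrite mulf_eq0 gt_eqF // lt_eqF.
(* For [k <= 0] and [qstress o > 0], [l o = W o - k * qstress o] is positive. *)
have pos o : 0 < qstress o -> tight x o.
  move=> qo; have [//|e] := VE o; apply: lt; apply/eqP => lo0.
  move: e; rewrite lo0 subr0 /W max_l ?(ltW qo) // => e.
  by have := mulr_le0_ge0 k0 (ltW qo); rewrite -e leNgt qo.
have /YfP[_ xc] := Yx.
have term o : 0 <= - (qstress o * (constr x o - rhs o)).
  rewrite oppr_ge0; have [/pos ->|q0] := ltP 0 (qstress o); first by rewrite subrr mulr0.
  by rewrite mulr_le0_ge0 // subr_ge0.
(* The terms are nonnegative and sum to [fourSum], which is at most 0, so all vanish. *)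
have /eqP : \sum_o - (qstress o * (constr x o - rhs o)) = 0.
  apply/eqP; rewrite eq_le sumr_ge0 ?andbT //.
  by rewrite sumrN qstress_slack opprK.
rewrite psumr_eq0 => [/allP zero o qo|o _]; last exact: term.
have := zero o (mem_index_enum _).
by rewrite /= oppr_eq0 mulf_eq0 lt_eqF //= subr_eq0 => /eqP.
Qed.

End FourPoints.

End Polyhedron.

Theorem mainTheorem17 (R : realType) (n : nat) (p : 'I_n -> pt R)
  (fe : 'I_n -> 'I_n -> R) (f0 : 'I_n -> R) :
  (4 <= n)%N ->
  general_position p ->
  (forall i1 i2 : 'I_n, val i1 = 0%N -> val i2 = 1%N -> (p i1).2 != (p i2).2) ->
  (valid p fe f0 <->
   forall Q : {set 'I_n}, #|Q| = 4%N -> 0 < fourSum p fe f0 Q).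
Proof.
move=> n4 gp p01; rewrite valid_pointwise; split=> [nc Q Q4|sums x Yx].
  rewrite ltNge; apply/negP => sum0.
  have [x Yx /(neg_supportP p fe f0 Q)] := fourSum_le0_neg_support n4 gp p01 Q4 nc sum0.
  exact: (non_crossing_neg_support gp (nc x Yx) Q4).
apply: (neg_support_non_crossing gp n4) => [i j []//|Q Q4].
by move/neg_supportP; apply: (fourSum_gt0_no_neg_support gp Q4 Yx); exact: sums.
Qed.
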